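(* Let $A \in \mathbb{R}^{m\times n}$ have full column rank, i.e. $\operatorname{rank}(A)=n$, let $R_s \in \mathbb{R}^{n\times n}$ be upper triangular and nonsingular, and let $E \in \mathbb{R}^{n\times n}$. Define $$A_1 \equiv A R_s^{-1}, \qquad \widehat{A_1} \equiv A (R_s+E)^{-1}, \qquad \varepsilon \equiv \frac{\|E\|_2}{\|R_s\|_2}.$$ If $\|E\|_2\,\|R_s^{-1}\|_2 < 1$, then $$\kappa_2(\widehat{A_1}) \;\le\; \kappa_2(A_1)\,\frac{1+\varepsilon\,\kappa_2(R_s)}{1-\varepsilon\,\kappa_2(R_s)}.$$
   Context: Here $m \ge n \ge 1$ (the paper's interest is in tall-and-skinny matrices, $m \gg n$). $\|\cdot\|_2$ is the matrix 2-norm (spectral norm). For a real matrix $B$ with full column rank, $\kappa_2(B)$ is the ratio of its largest singular value to its smallest singular value; equivalently $\kappa_2(B)=\|B\|_2\|B^{\dagger}\|_2$ with $B^\dagger$ the Moore–Penrose inverse, so for nonsingular $R_s$, $\kappa_2(R_s)=\|R_s\|_2\|R_s^{-1}\|_2$. In the paper $R_s$ is the upper triangular factor of a thin QR decomposition of $\Omega A\in\mathbb{R}^{c\times n}$ for some sketching matrix $\Omega\in\mathbb{R}^{c\times m}$ with $c \ge n$, and $E$ is the perturbation caused by computing $R_s$ in reduced precision; only the assumptions listed in the claim are imposed on them. *)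

(* Defs.v *)
From mathcomp Require Export all_boot all_order all_algebra.
From mathcomp Require Export classical_sets reals.

Set Implicit Arguments.
Unset Strict Implicit.
Unset Printing Implicit Defensive.

Import Order.TTheory GRing.Theory Num.Theory.
Local Open Scope classical_set_scope.
Local Open Scope ring_scope.

(* The norm that the library puts on matrices is the entrywise maximum, so the
   Euclidean norm is defined here. *)
Definition norm2 (R : realType) (n : nat) (x : 'cV[R]_n) : R :=
  Num.sqrt (\sum_(i < n) x i 0 ^+ 2).

Definition mxnorm2 (R : realType) (m n : nat) (B : 'M[R]_(m, n)) : R :=
  sup [set norm2 (B *m x) | x in [set x : 'cV[R]_n | norm2 x = 1]].

(* This is the usual set of singular values when
   n <= m, in particular when B has full column rank; for m < n, it also
   contains the square roots of the extra null eigenvalues of B^T B. *)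
Definition singular_values (R : realType) (m n : nat) (B : 'M[R]_(m, n)) :
    set R :=
  [set s | 0 <= s /\ eigenvalue (B^T *m B) (s ^+ 2)].

(* For n > 0, [singular_values B] is finite and nonempty, so the supremum and
   the infimum are the largest and the smallest singular values. The quotient
   is the condition number for B of full column rank; otherwise the
   denominator is 0 and the quotient is the junk value 0. *)
Definition kappa2 (R : realType) (m n : nat) (B : 'M[R]_(m, n)) : R :=
  sup (singular_values B) / inf (singular_values B).

(* Main.v *)
Require Import Defs.
From mathcomp Require Import all_boot all_order all_algebra.
From mathcomp Require Import classical_sets reals.
From mathcomp Require Import ring lra.

Set Implicit Arguments.
Unset Strict Implicit.
Unset Printing Implicit Defensive.

(** Put [F = E Rs^-1] and [G = 1 + F]. Then [Rs + E = G Rs], so the perturbed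
    matrix is [A1 G^-1], and everything rests on how far [G] is from an
    isometry. With [eta = |E| |Rs^-1|] we have [|F x| <= eta |x|], and the
    triangle inequality gives
      [(1 - eta) |x| <= |G x| <= (1 + eta) |x|].
    As [eta < 1], [G] is invertible, and substituting [x = G^-1 y] shows that
    the largest stretching factor of [A1 G^-1] is at most that of [A1] divided
    by [1 - eta] ([mxnorm2_mul_invmx]), while the smallest one is at least that
    of [A1] divided by [1 + eta] ([minmod_mul_invmx]). The quotient of these
    bounds is the claim, because [eps * kappa2 Rs = eta]: the smallest
    stretching factor of [Rs] is [1 / |Rs^-1|] ([minmod_unitmx]).

    This argument speaks of stretching factors, whereas [kappa2] is defined
    from eigenvalues of [B^T B]. The bridge is [kappa2E]: the supremum and the
    infimum of [|B x|] over the unit sphere are the extreme singular values.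
    Neither compactness of the sphere nor diagonalization enters. If [l] is
    the supremum, the symmetric matrix [N = l^2 - B^T B] is positive
    semidefinite. Were [l^2] not an eigenvalue of [B^T B], [N] would be
    invertible, hence coercive, [c |x|^2 <= x^T N x] with [c > 0]
    ([psd_unitmx_coercive]); then [|B x|^2 <= (l^2 - c) |x|^2], so [l] would
    not be the supremum. The infimum is treated in the same way with
    [N = B^T B - l^2]. *)

Import Order.TTheory GRing.Theory Num.Theory.
Local Open Scope ring_scope.

(** * Euclidean geometry of column vectors *)

Definition dot (R : realType) (n : nat) (x y : 'cV[R]_n) : R := (x^T *m y) 0 0.

Section Euclidean.
Variables (R : realType) (n : nat).
Implicit Types (x y z : 'cV[R]_n) (a : R).

Lemma dotE x y : dot x y = \sum_i x i 0 * y i 0.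
Proof. by rewrite /dot mxE; apply: eq_bigr => i _; rewrite mxE. Qed.

Lemma dotC x y : dot x y = dot y x.
Proof. by rewrite !dotE; apply: eq_bigr => i _; rewrite mulrC. Qed.

Lemma dotDr x y z : dot x (y + z) = dot x y + dot x z.
Proof. by rewrite /dot mulmxDr mxE. Qed.

Lemma dotDl x y z : dot (x + y) z = dot x z + dot y z.
Proof. by rewrite dotC dotDr !(dotC z). Qed.

Lemma dotZr a x y : dot x (a *: y) = a * dot x y.
Proof. by rewrite /dot -scalemxAr mxE. Qed.

Lemma dotZl a x y : dot (a *: x) y = a * dot x y.
Proof. by rewrite dotC dotZr dotC. Qed.

Lemma dotNr x y : dot x (- y) = - dot x y.
Proof. by rewrite -scaleN1r dotZr mulN1r. Qed.

Lemma norm2_ge0 x : 0 <= norm2 x.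
Proof. exact: sqrtr_ge0. Qed.

Lemma norm2_sqr x : norm2 x ^+ 2 = dot x x.
Proof.
rewrite /norm2 sqr_sqrtr; last by apply: sumr_ge0 => i _; exact: sqr_ge0.
by rewrite dotE; apply: eq_bigr => i _; rewrite expr2.
Qed.

Lemma norm2_eq0 x : norm2 x = 0 -> x = 0.
Proof.
move=> x0; have : dot x x = 0 by rewrite -norm2_sqr x0 expr0n.
rewrite dotE => /psumr_eq0P s0; apply/colP => i.
have /eqP := s0 (fun j _ => sqr_ge0 (x j 0)) i isT.
by rewrite mulf_eq0 orbb mxE => /eqP.
Qed.

Lemma norm2_gt0 x : x != 0 -> 0 < norm2 x.
Proof.
by move=> x0; rewrite lt0r norm2_ge0 andbT; apply: contra_neq x0 => /norm2_eq0.
Qed.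

Lemma norm20 : norm2 (0 : 'cV[R]_n) = 0.
Proof. by rewrite /norm2 big1 ?sqrtr0 // => i _; rewrite mxE expr0n. Qed.

Lemma norm2Z a x : norm2 (a *: x) = `|a| * norm2 x.
Proof.
rewrite /norm2 -sqrtr_sqr -sqrtrM ?sqr_ge0 // mulr_sumr; congr Num.sqrt.
by apply: eq_bigr => i _; rewrite mxE exprMn.
Qed.

Lemma norm2_normalize x : x != 0 -> norm2 ((norm2 x)^-1 *: x) = 1.
Proof.
move=> /norm2_gt0 x0; rewrite norm2Z ger0_norm ?invr_ge0 ?norm2_ge0 //.
by rewrite mulVf ?gt_eqF.
Qed.

Lemma ler_of_sqr (b c : R) : 0 <= c -> b ^+ 2 <= c ^+ 2 -> b <= c.
Proof. by move=> c0 bc; rewrite leNgt; apply/negP => cb; nra. Qed.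

(** The quadratic [|x + t y|^2] in [t] is nonnegative at its minimizer
    [t = - dot x y / |y|^2]. *)
Lemma cauchy_schwarz x y : dot x y <= norm2 x * norm2 y.
Proof.
have [->|/norm2_gt0 y0] := eqVneq y 0.
  by rewrite norm20 mulr0 /dot mulmx0 mxE.
apply: ler_of_sqr; first by rewrite mulr_ge0 ?norm2_ge0.
set t := - (dot x y / norm2 y ^+ 2).
have := norm2_sqr (x + t *: y); have := sqr_ge0 (norm2 (x + t *: y)).
rewrite !dotDr !dotDl !dotZr !dotZl -!norm2_sqr (dotC y x) => h e.
have ety : t * norm2 y ^+ 2 = - dot x y.
  by rewrite mulNr divfK ?expf_neq0 ?gt_eqF.
rewrite e ety in h; rewrite exprMn.
set q := (X in 0 <= X) in h.
have : 0 <= q * norm2 y ^+ 2 by rewrite mulr_ge0 ?sqr_ge0.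
have -> : q * norm2 y ^+ 2 =
    norm2 x ^+ 2 * norm2 y ^+ 2 + dot x y * (t * norm2 y ^+ 2).
  by rewrite /q; ring.
by rewrite ety; lra.
Qed.

Lemma norm2D x y : norm2 (x + y) <= norm2 x + norm2 y.
Proof.
apply: ler_of_sqr; first by rewrite addr_ge0 ?norm2_ge0.
rewrite norm2_sqr !dotDr !dotDl -!norm2_sqr (dotC y x).
by have := cauchy_schwarz x y; nra.
Qed.

End Euclidean.

Lemma dot_mulmxl (R : realType) (m n : nat) (B : 'M[R]_(m, n)) x y :
  dot (B *m x) y = dot x (B^T *m y).
Proof. by rewrite /dot trmx_mul mulmxA. Qed.

(** The constant is the Frobenius norm, by Cauchy-Schwarz on each row; 1 is
    added to it so that it is positive even for the zero matrix. *)
Lemma norm2_mulmx_bounded (R : realType) (m n : nat) (B : 'M[R]_(m, n)) :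
  exists2 C, 0 < C & forall x, norm2 (B *m x) <= C * norm2 x.
Proof.
pose C := \sum_i norm2 (row i B)^T ^+ 2.
have C0 : 0 <= C by apply: sumr_ge0 => i _; exact: sqr_ge0.
exists (Num.sqrt C + 1); first by rewrite ltr_wpDl ?sqrtr_ge0.
move=> x; apply: (@le_trans _ _ (Num.sqrt C * norm2 x)); last first.
  by rewrite ler_wpM2r ?norm2_ge0 // lerDl.
rewrite -[norm2 x]ger0_norm ?norm2_ge0 // -sqrtr_sqr -sqrtrM //.
rewrite {1}/norm2 ler_wsqrtr // mulr_suml; apply: ler_sum => i _.
have -> : (B *m x) i 0 = dot (row i B)^T x.
  by rewrite /dot trmxK -row_mul [RHS]mxE.
rewrite -exprMn -[leLHS]real_normK ?num_real //.
rewrite (@ler_pXn2r _ 2) ?nnegrE ?mulr_ge0 ?norm2_ge0 //.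
rewrite ler_norml cauchy_schwarz andbT lerNl.
have := cauchy_schwarz (- (row i B)^T) x.
by rewrite -scaleN1r dotZl norm2Z normrN1 mulN1r mul1r.
Qed.

(** * Coercivity of invertible positive semidefinite forms *)

(** Let [q x = x^T N x], whose gradient at [x] is [2 N x]. One gradient step
    from [x] decreases [q] by an amount of order [|N x|^2], yet [q] stays
    nonnegative; hence [|N x|^2] is at most a constant times [q x]. As [N] is
    invertible, [|x|^2] is in turn at most a constant times [|N x|^2]. *)
Lemma psd_unitmx_coercive (R : realType) (n : nat) (N : 'M[R]_n) :
    N^T = N -> (forall x, 0 <= dot x (N *m x)) -> N \in unitmx ->
  exists2 c, 0 < c & forall x, c * norm2 x ^+ 2 <= dot x (N *m x).
Proof.
move=> Nsym Npsd Nunit.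
have [K K0 leK] := norm2_mulmx_bounded N.
have [C C0 leC] := norm2_mulmx_bounded (invmx N).
have CK0 : 0 < C ^+ 2 * K by rewrite mulr_gt0 ?exprn_gt0.
exists (C ^+ 2 * K)^-1; first by rewrite invr_gt0.
move=> x; set y := N *m x.
have leqy : dot y (N *m y) <= K * norm2 y ^+ 2.
  apply: le_trans (cauchy_schwarz _ _) _.
  by have := leK y; have := norm2_ge0 y; nra.
have lex : norm2 x ^+ 2 <= C ^+ 2 * norm2 y ^+ 2.
  have := leC y; rewrite mulKmx // => h; rewrite -exprMn.
  by rewrite ler_pXn2r ?nnegrE ?mulr_ge0 ?norm2_ge0 // ltW.
(* Evaluate the form at x - t y: t = 1 / K minimizes the resulting bound
   q x - 2 t |y|^2 + t^2 K |y|^2. *)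
have descent : norm2 y ^+ 2 <= K * dot x y.
  have := Npsd (x - K^-1 *: y).
  rewrite mulmxBr -scalemxAr -/y -!scaleNr !dotDr !dotDl !dotZr !dotZl.
  have -> : dot x (N *m y) = dot y y by rewrite -{1}Nsym -dot_mulmxl.
  rewrite -norm2_sqr; set q := (X in 0 <= X) => q0.
  have : 0 <= K ^+ 2 * q by rewrite mulr_ge0 ?sqr_ge0.
  have -> : K ^+ 2 * q =
      K ^+ 2 * dot x y - 2 * K * norm2 y ^+ 2 + dot y (N *m y).
    by rewrite /q; field; rewrite gt_eqF.
  by nra.
rewrite mulrC ler_pdivrMr //; nra.
Qed.

(** * Extreme stretching factors and extreme singular values *)

(** The minimum modulus of [B], dual to the operator norm [mxnorm2]. *)
Definition minmod (R : realType) (m n : nat) (B : 'M[R]_(m, n)) : R :=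
  inf [set norm2 (B *m x) | x in [set x : 'cV[R]_n | norm2 x = 1]].

Section Extrema.
Variables (R : realType) (m n : nat).
Hypothesis n_gt0 : (0 < n)%N.
Implicit Type B : 'M[R]_(m, n).

Lemma exists_norm2_eq1 : exists x : 'cV[R]_n, norm2 x = 1.
Proof.
pose x : 'cV[R]_n := delta_mx (Ordinal n_gt0) 0.
exists ((norm2 x)^-1 *: x); apply: norm2_normalize.
apply/eqP => /matrixP/(_ (Ordinal n_gt0) 0)/eqP.
by rewrite !mxE !eqxx oner_eq0.
Qed.

Lemma norm2_le_mxnorm2 B x : norm2 (B *m x) <= mxnorm2 B * norm2 x.
Proof.
have [->|x0] := eqVneq x 0; first by rewrite mulmx0 !norm20 mulr0.
rewrite -ler_pdivrMr ?norm2_gt0 //; apply: ub_le_sup.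
  have [C _ leC] := norm2_mulmx_bounded B.
  by exists C => _ [z /= z1 <-]; rewrite -[C]mulr1 -z1.
exists ((norm2 x)^-1 *: x); first exact: norm2_normalize.
by rewrite -scalemxAr norm2Z ger0_norm ?invr_ge0 ?norm2_ge0 // mulrC.
Qed.

Lemma minmod_le_norm2 B x : minmod B * norm2 x <= norm2 (B *m x).
Proof.
have [->|x0] := eqVneq x 0; first by rewrite mulmx0 !norm20 mulr0.
rewrite -ler_pdivlMr ?norm2_gt0 //; apply: ge_inf.
  by exists 0 => _ [z _ <-]; exact: norm2_ge0.
exists ((norm2 x)^-1 *: x); first exact: norm2_normalize.
by rewrite -scalemxAr norm2Z ger0_norm ?invr_ge0 ?norm2_ge0 // mulrC.
Qed.

Lemma mxnorm2_le B (c : R) :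
  (forall x, norm2 (B *m x) <= c * norm2 x) -> mxnorm2 B <= c.
Proof.
move=> leB; apply: ge_sup.
  by have [x x1] := exists_norm2_eq1; exists (norm2 (B *m x)), x.
by move=> _ [x /= x1 <-]; rewrite -[c]mulr1 -x1.
Qed.

Lemma le_minmod B (c : R) :
  (forall x, c * norm2 x <= norm2 (B *m x)) -> c <= minmod B.
Proof.
move=> leB; apply: lb_le_inf.
  by have [x x1] := exists_norm2_eq1; exists (norm2 (B *m x)), x.
by move=> _ [x /= x1 <-]; rewrite -[c]mulr1 -x1.
Qed.

Lemma mxnorm2_ge0 B : 0 <= mxnorm2 B.
Proof.
have [x x1] := exists_norm2_eq1; have := norm2_le_mxnorm2 B x.
by rewrite x1 mulr1; apply: le_trans (norm2_ge0 _).
Qed.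

Lemma minmod_ge0 B : 0 <= minmod B.
Proof. by apply: le_minmod => x; rewrite mul0r norm2_ge0. Qed.

Lemma gram_sym B : (B^T *m B)^T = B^T *m B.
Proof. by rewrite trmx_mul trmxK. Qed.

Lemma dot_gram B x : dot x (B^T *m B *m x) = norm2 (B *m x) ^+ 2.
Proof. by rewrite -mulmxA -dot_mulmxl norm2_sqr. Qed.

(** A normalized eigenvector of [B^T B] for [s^2] is stretched by exactly [s].
    [eigenvalue] refers to row eigenvectors, hence the transpositions. *)
Lemma singular_value_norm2 B (s : R) : singular_values B s ->
  exists2 x, norm2 x = 1 & norm2 (B *m x) = s.
Proof.
case=> s0 /eigenvalueP [v vB v0].
have vT0 : v^T != 0 by rewrite trmx_eq0.
have BvT : norm2 (B *m v^T) = s * norm2 v^T.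
  rewrite -[LHS]ger0_norm ?norm2_ge0 // -sqrtr_sqr -dot_gram.
  rewrite -(gram_sym B) -trmx_mul vB linearZ /= dotZr -norm2_sqr -exprMn.
  by rewrite sqrtr_sqr ger0_norm ?mulr_ge0 ?norm2_ge0.
exists ((norm2 v^T)^-1 *: v^T); first exact: norm2_normalize.
rewrite -scalemxAr norm2Z ger0_norm ?invr_ge0 ?norm2_ge0 // BvT mulrCA.
by rewrite mulVf ?mulr1 // gt_eqF ?norm2_gt0.
Qed.

Lemma not_eigenvalue_unitmx (M : 'M[R]_n) (a : R) :
  ~~ eigenvalue M a -> M - a%:M \in unitmx.
Proof. by rewrite negbK /eigenspace kermx_eq0 row_free_unit. Qed.

(** Otherwise [mxnorm2 B ^+ 2 - B^T B] would be coercive, which leaves room for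
    a smaller upper bound on the stretching factors. *)
Lemma singular_value_mxnorm2 B : singular_values B (mxnorm2 B).
Proof.
split; first exact: mxnorm2_ge0.
set l := mxnorm2 B; have l0 : 0 <= l := mxnorm2_ge0 B.
apply: contraT => /not_eigenvalue_unitmx.
rewrite -opprB -scaleN1r unitmxZ ?unitrN1 // => Nunit.
have qE x : dot x (((l ^+ 2)%:M - B^T *m B) *m x) =
    l ^+ 2 * norm2 x ^+ 2 - norm2 (B *m x) ^+ 2.
  by rewrite mulmxBl mul_scalar_mx dotDr dotNr dotZr dot_gram !norm2_sqr.
have [||c c0 lec] := psd_unitmx_coercive _ _ Nunit.
- by rewrite linearB /= tr_scalar_mx gram_sym.
- move=> x; rewrite qE subr_ge0 -exprMn.
  by rewrite ler_pXn2r ?nnegrE ?mulr_ge0 ?norm2_ge0 // norm2_le_mxnorm2.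
have le1 x : norm2 (B *m x) ^+ 2 <= (l ^+ 2 - c) * norm2 x ^+ 2.
  by have := lec x; rewrite qE; lra.
have lc0 : 0 <= l ^+ 2 - c.
  have [x x1] := exists_norm2_eq1; have := le1 x.
  by rewrite x1 expr1n mulr1; apply: le_trans (sqr_ge0 _).
have : l <= Num.sqrt (l ^+ 2 - c).
  apply: mxnorm2_le => x; apply: ler_of_sqr.
    by rewrite mulr_ge0 ?sqrtr_ge0 ?norm2_ge0.
  by rewrite exprMn (sqr_sqrtr lc0); exact: le1.
move=> h; have : l ^+ 2 <= l ^+ 2 - c.
  by rewrite -[leRHS](sqr_sqrtr lc0) ler_pXn2r ?nnegrE ?sqrtr_ge0.
by lra.
Qed.

(** As for the norm, with the opposite sign: coercivity of
    [B^T B - minmod B ^+ 2] would leave room for a larger lower bound. *)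
Lemma singular_value_minmod B : singular_values B (minmod B).
Proof.
split; first exact: minmod_ge0.
set l := minmod B; have l0 : 0 <= l := minmod_ge0 B.
apply: contraT => /not_eigenvalue_unitmx Nunit.
have qE x : dot x ((B^T *m B - (l ^+ 2)%:M) *m x) =
    norm2 (B *m x) ^+ 2 - l ^+ 2 * norm2 x ^+ 2.
  by rewrite mulmxBl mul_scalar_mx dotDr dotNr dotZr dot_gram !norm2_sqr.
have [||c c0 lec] := psd_unitmx_coercive _ _ Nunit.
- by rewrite linearB /= tr_scalar_mx gram_sym.
- move=> x; rewrite qE subr_ge0 -exprMn.
  by rewrite ler_pXn2r ?nnegrE ?mulr_ge0 ?norm2_ge0 // minmod_le_norm2.
have lc0 : 0 <= l ^+ 2 + c by rewrite addr_ge0 ?sqr_ge0 // ltW.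
have h : Num.sqrt (l ^+ 2 + c) <= l.
  apply: le_minmod => x; apply: ler_of_sqr; first exact: norm2_ge0.
  by rewrite exprMn (sqr_sqrtr lc0); have := lec x; rewrite qE; lra.
have : l ^+ 2 + c <= l ^+ 2.
  by rewrite -[leLHS](sqr_sqrtr lc0) ler_pXn2r ?nnegrE ?sqrtr_ge0.
by lra.
Qed.

Lemma sup_singular_values B : sup (singular_values B) = mxnorm2 B.
Proof.
have ub : ubound (singular_values B) (mxnorm2 B).
  move=> s /singular_value_norm2 [x x1 <-].
  by have := norm2_le_mxnorm2 B x; rewrite x1 mulr1.
have svm := singular_value_mxnorm2 B; apply/eqP; rewrite eq_le.
by rewrite ge_sup ?ub_le_sup //; [exists (mxnorm2 B) | exists (mxnorm2 B)].
Qed.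

Lemma inf_singular_values B : inf (singular_values B) = minmod B.
Proof.
have lb : lbound (singular_values B) (minmod B).
  move=> s /singular_value_norm2 [x x1 <-].
  by have := minmod_le_norm2 B x; rewrite x1 mulr1.
have svm := singular_value_minmod B; apply/eqP; rewrite eq_le.
by rewrite ge_inf ?lb_le_inf //; [exists (minmod B) | exists (minmod B)].
Qed.

Lemma kappa2E B : kappa2 B = mxnorm2 B / minmod B.
Proof. by rewrite /kappa2 sup_singular_values inf_singular_values. Qed.

(** The infimum is attained, so if it were 0 some unit vector would be in the
    kernel of [B], which a left inverse of [B] forbids. *)
Lemma minmod_gt0 B : row_full B -> 0 < minmod B.
Proof.
move=> /row_fullP [L LB]; rewrite lt0r minmod_ge0 andbT; apply/eqP => min0.
have [x x1 /eqP] := singular_value_norm2 (singular_value_minmod B).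
rewrite min0 => /eqP/norm2_eq0 Bx0.
have := oner_eq0 R.
by rewrite -x1 -[x]mul1mx -LB -mulmxA Bx0 mulmx0 norm20 eqxx.
Qed.

(** * Stretching factors after multiplication by an inverse *)

(** Evaluate at [y = G x]: then [B G^-1 y = B x], and [|x| <= |y| / a]. *)
Lemma mxnorm2_mul_invmx B (G : 'M[R]_n) (a : R) : 0 < a -> G \in unitmx ->
    (forall x, a * norm2 x <= norm2 (G *m x)) ->
  mxnorm2 (B *m invmx G) <= mxnorm2 B / a.
Proof.
move=> a0 Gunit leG; apply: mxnorm2_le => y.
rewrite -mulmxA; apply: le_trans (norm2_le_mxnorm2 _ _) _.
rewrite -mulrA ler_wpM2l ?mxnorm2_ge0 // mulrC ler_pdivlMr // mulrC.
by have := leG (invmx G *m y); rewrite mulKVmx.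
Qed.

Lemma minmod_mul_invmx B (G : 'M[R]_n) (b : R) : 0 < b -> G \in unitmx ->
    (forall x, norm2 (G *m x) <= b * norm2 x) ->
  minmod B / b <= minmod (B *m invmx G).
Proof.
move=> b0 Gunit leG; apply: le_minmod => y.
rewrite -mulmxA; apply: le_trans (minmod_le_norm2 _ _).
rewrite -mulrA ler_wpM2l ?minmod_ge0 // mulrC ler_pdivrMr // mulrC.
by have := leG (invmx G *m y); rewrite mulKVmx.
Qed.

End Extrema.

Lemma injective_unitmx (R : realType) (n : nat) (G : 'M[R]_n) :
  (forall x : 'cV_n, G *m x = 0 -> x = 0) -> G \in unitmx.
Proof.
move=> Ginj; rewrite -unitmx_tr -row_free_unit; apply: inj_row_free => v vG.
apply: trmx_inj; rewrite trmx0; apply: Ginj.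
by rewrite -[G]trmxK -trmx_mul vG trmx0.
Qed.

(** [T] shrinks [x] by exactly the factor by which [T^-1] stretches [T x], and
    every vector is of the form [T x]. *)
Lemma minmod_unitmx (R : realType) (n : nat) (T : 'M[R]_n) :
  (0 < n)%N -> T \in unitmx -> minmod T = (mxnorm2 (invmx T))^-1.
Proof.
move=> n0 Tunit; have Tfull : row_full T by rewrite row_full_unit.
have T0 := minmod_gt0 n0 Tfull.
have le1 : mxnorm2 (invmx T) <= (minmod T)^-1.
  apply: mxnorm2_le => // y; rewrite mulrC ler_pdivlMr // mulrC.
  by have := minmod_le_norm2 T (invmx T *m y); rewrite mulKVmx.
have inv0 : 0 < mxnorm2 (invmx T).
  have [x x1] := exists_norm2_eq1 R n0.
  have := norm2_le_mxnorm2 (invmx T) (T *m x); rewrite mulKmx // x1.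
  by have := mxnorm2_ge0 n0 (invmx T); have := norm2_ge0 (T *m x); nra.
apply/eqP; rewrite eq_le -[X in X <= _]invrK lef_pV2 ?posrE ?invr_gt0 // le1 /=.
apply: le_minmod => // x; rewrite mulrC ler_pdivrMr // mulrC.
by have := norm2_le_mxnorm2 (invmx T) (T *m x); rewrite mulKmx.
Qed.

(** * The perturbation bound *)

Theorem theorem1 (R : realType) (m n : nat) (n_ge1 : (1 <= n)%N)
    (n_le_m : (n <= m)%N) (A : 'M[R]_(m, n)) (Rs E : 'M[R]_n)
    (rankA : \rank A = n)
    (Rs_upper : forall i j : 'I_n, (j < i)%N -> Rs i j = 0)
    (Rs_unit : Rs \in unitmx)
    (E_small : mxnorm2 E * mxnorm2 (invmx Rs) < 1) :
  let A1 := A *m invmx Rs in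
  let A1hat := A *m invmx (Rs + E) in
  let eps := mxnorm2 E / mxnorm2 Rs in
  kappa2 A1hat <=
    kappa2 A1 * ((1 + eps * kappa2 Rs) / (1 - eps * kappa2 Rs)).
Proof.
rewrite /=; set A1 := A *m invmx Rs; set A1hat := A *m invmx (Rs + E).
set eps := mxnorm2 E / mxnorm2 Rs.
set eta := mxnorm2 E * mxnorm2 (invmx Rs) in E_small.
have Rs_min := minmod_unitmx n_ge1 Rs_unit.
have Rs_norm0 : 0 < mxnorm2 Rs.
  have [x x1] := exists_norm2_eq1 R n_ge1.
  have := norm2_le_mxnorm2 Rs x; rewrite x1 mulr1; apply: lt_le_trans.
  have := minmod_le_norm2 Rs x; rewrite x1 mulr1; apply: lt_le_trans.
  by apply: minmod_gt0 => //; rewrite row_full_unit.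
have -> : eps * kappa2 Rs = eta.
  by rewrite kappa2E // Rs_min invrK mulrA divfK ?gt_eqF.
have eta0 : 0 <= eta by rewrite mulr_ge0 ?mxnorm2_ge0.
pose F := E *m invmx Rs; pose G := 1%:M + F.
have leF x : norm2 (F *m x) <= eta * norm2 x.
  rewrite -mulmxA; apply: le_trans (norm2_le_mxnorm2 _ _) _.
  by rewrite -mulrA ler_wpM2l ?mxnorm2_ge0 // norm2_le_mxnorm2.
have G_upper x : norm2 (G *m x) <= (1 + eta) * norm2 x.
  rewrite mulmxDl mul1mx; apply: le_trans (norm2D _ _) _.
  by have := leF x; lra.
have G_lower x : (1 - eta) * norm2 x <= norm2 (G *m x).
  have := norm2D (G *m x) (- (F *m x)).
  rewrite -scaleN1r norm2Z normrN1 mul1r scaleN1r mulmxDl mul1mx addrK.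
  by have := leF x; lra.
have lo0 : 0 < 1 - eta by lra.
have hi0 : 0 < 1 + eta by lra.
have Gunit : G \in unitmx.
  apply: injective_unitmx => x Gx0; apply: norm2_eq0; apply/eqP.
  rewrite eq_le norm2_ge0 andbT; have := G_lower x.
  by rewrite Gx0 norm20 pmulr_rle0.
have A1hatE : A1hat = A1 *m invmx G.
  have GRs : G *m Rs = Rs + E by rewrite mulmxDl mul1mx mulmxKV.
  have GRs_unit : G *m Rs \in unitmx by rewrite unitmx_mul Gunit.
  by rewrite -[RHS](mulmxK GRs_unit) mulmxA !mulmxKV // GRs.
have A1_full : row_full A1.
  by rewrite /row_full mxrankMfree ?rankA // row_free_unit unitmx_inv.
have A1_min0 := minmod_gt0 n_ge1 A1_full.
have max_le := mxnorm2_mul_invmx n_ge1 A1 lo0 Gunit G_lower.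
have min_ge := minmod_mul_invmx n_ge1 A1 hi0 Gunit G_upper.
rewrite !kappa2E // A1hatE.
have -> : mxnorm2 A1 / minmod A1 * ((1 + eta) / (1 - eta)) =
    (mxnorm2 A1 / (1 - eta)) * (minmod A1 / (1 + eta))^-1.
  by field; rewrite !gt_eqF.
have q0 : 0 < minmod A1 / (1 + eta) by rewrite divr_gt0.
apply: ler_pM => //; rewrite ?mxnorm2_ge0 ?invr_ge0 ?minmod_ge0 //.
by rewrite lef_pV2 ?posrE // (lt_le_trans q0).
Qed.
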